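(* The roots of a max-plus polynomial in one variable can be computed in linear time. That is, there is an algorithm which, given the coefficients $P_0,\dots,P_n\in\mathbb{R}\cup\{-\infty\}$, $P_n\ne-\infty$, of a max-plus polynomial of degree $n\geq 1$, with associated polynomial function $p(x)=\max_{0\le k\le n}(P_k+kx)$, computes the $n$ roots $c_1,\dots,c_n\in\mathbb{R}\cup\{-\infty\}$ of this polynomial, counted with multiplicities, in $O(n)$ arithmetical operations and comparisons.
   Context: The max-plus semiring $\mathbb{R}_{\max}$ is the set $\mathbb{R}\cup\{-\infty\}$ equipped with $\max$ as addition and the usual addition $+$ as multiplication. A max-plus (formal) polynomial of degree $n$ in one variable is a formal expression $P=\bigoplus_{0\le k\le n}P_kX^k$ with coefficients $P_k\in\mathbb{R}_{\max}$ and $P_n\neq-\infty$; its associated polynomial function is, in the notation of classical algebra, $p(x)=\max_{0\le k\le n}(P_k+kx)$. It is known (Cuninghame-Green and Meijer) that $p$ can be written uniquely, up to the order of the $c_k$, as \[ p(x)=P_n+\sum_{1\le k\le n}\max(x,c_k),\qquad c_1,\dots,c_n\in\mathbb{R}_{\max}. \] The numbers $c_1,\dots,c_n$ are called the roots of $P$ (the finite roots are the points at which the maximum defining $p$ is attained at least twice). The multiplicity of a root $c$ is the cardinality of $\{k\in\{1,\dots,n\}: c_k=c\}$. Computation time is measured by the number of arithmetical operations and comparisons on (extended) real numbers. *)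

(* Defs.v *)
From mathcomp Require Import all_boot all_order all_algebra.
From mathcomp Require Import reals constructive_ereal.

Set Implicit Arguments.
Unset Strict Implicit.
Unset Printing Implicit Defensive.

Import Order.TTheory GRing.Theory Num.Theory.

Local Open Scope ereal_scope.

(** * Max-plus polynomials *)

(** R_max = R \cup {-oo} is seen inside the library's extended reals. *)
Definition in_Rmax (R : realType) (x : \bar R) : bool := x != +oo.

(** [P k] is the coefficient of X^k.  The degree is exactly [n]. *)
Definition mp_poly (R : realType) (n : nat) (P : 'I_n.+1 -> \bar R) : Prop :=
  (forall k, in_Rmax (P k)) /\ P ord_max != -oo.

(** The max-plus power x^k is [x *+ k]; in particular [-oo *+ 0 = 0], the
    max-plus unit. *)
Definition mp_fun (R : realType) (n : nat) (P : 'I_n.+1 -> \bar R)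
    (x : \bar R) : \bar R :=
  \big[maxe/-oo]_(k < n.+1) (P k + x *+ k).

(** [c] lists the roots of [P], each repeated according to its multiplicity. *)
Definition mp_roots (R : realType) (n : nat) (P : 'I_n.+1 -> \bar R)
    (c : 'I_n -> \bar R) : Prop :=
  (forall k, in_Rmax (c k)) /\
  forall x, in_Rmax x ->
    mp_fun P x = P ord_max + \sum_(k < n) maxe x (c k).

(** * Algorithms

    Programs of a real random access machine with structured control flow.
    The memory consists of arrays of natural numbers (indices) and arrays of
    extended reals; array names are literals in the program, positions in an
    array are computed.  A scalar variable is a cell at a literal position.
    Extended reals influence indices and control only through comparisons. *)

Inductive iexp : Type :=
| INum of nat
| IGet of nat & iexp            (* array name, position *)
| IAdd of iexp & iexp
| ISub of iexp & iexp.

Inductive eexp : Type :=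
| ENInfty
| EOfIdx of iexp
| EGet of nat & iexp            (* array name, position *)
| EAdd of eexp & eexp
| ESub of eexp & eexp
| EMul of eexp & eexp
| EDiv of eexp & eexp.

Inductive bexp : Type :=
| BLeI of iexp & iexp
| BLeE of eexp & eexp
| BNot of bexp
| BAnd of bexp & bexp.

Inductive cmd : Type :=
| Skip
| ISet of nat & iexp & iexp     (* array name, position, value *)
| ESet of nat & iexp & eexp     (* array name, position, value *)
| Seq of cmd & cmd
| If of bexp & cmd & cmd
| While of bexp & cmd.

Record state (R : realType) : Type := State {
  imem : nat -> nat -> nat;
  emem : nat -> nat -> \bar R
}.

Definition upd (T : Type) (m : nat -> nat -> T) (a i : nat) (v : T) :
    nat -> nat -> T :=
  fun b j => if (b == a) && (j == i) then v else m b j.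

Fixpoint ieval (R : realType) (s : state R) (e : iexp) : nat :=
  match e with
  | INum k => k
  | IGet a i => imem s a (ieval s i)
  | IAdd e1 e2 => (ieval s e1 + ieval s e2)%N
  | ISub e1 e2 => (ieval s e1 - ieval s e2)%N
  end.

Fixpoint eeval (R : realType) (s : state R) (e : eexp) : \bar R :=
  match e with
  | ENInfty => -oo
  | EOfIdx i => ((ieval s i)%:R%R)%:E
  | EGet a i => emem s a (ieval s i)
  | EAdd e1 e2 => eeval s e1 + eeval s e2
  | ESub e1 e2 => eeval s e1 - eeval s e2
  | EMul e1 e2 => eeval s e1 * eeval s e2
  | EDiv e1 e2 => eeval s e1 / eeval s e2
  end.

Fixpoint beval (R : realType) (s : state R) (b : bexp) : bool :=
  match b with
  | BLeI e1 e2 => (ieval s e1 <= ieval s e2)%N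
  | BLeE e1 e2 => eeval s e1 <= eeval s e2
  | BNot b1 => ~~ beval s b1
  | BAnd b1 b2 => beval s b1 && beval s b2
  end.

(** The cost of an expression is the number of arithmetical operations and
    comparisons it contains, on extended reals as well as on indices; a
    conversion of an index into a real counts for one operation.  Reading and
    writing the memory, Boolean connectives and jumps are free.  [BAnd] is
    charged for both of its arguments. *)

Fixpoint icost (e : iexp) : nat :=
  match e with
  | INum _ => 0
  | IGet _ i => icost i
  | IAdd e1 e2 | ISub e1 e2 => (icost e1 + icost e2).+1
  end.

Fixpoint ecost (e : eexp) : nat :=
  match e with
  | ENInfty => 0
  | EOfIdx i => (icost i).+1
  | EGet _ i => icost i
  | EAdd e1 e2 | ESub e1 e2 | EMul e1 e2 | EDiv e1 e2 =>
      (ecost e1 + ecost e2).+1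
  end.

Fixpoint bcost (b : bexp) : nat :=
  match b with
  | BLeI e1 e2 => (icost e1 + icost e2).+1
  | BLeE e1 e2 => (ecost e1 + ecost e2).+1
  | BNot b1 => bcost b1
  | BAnd b1 b2 => (bcost b1 + bcost b2)%N
  end.

(** [exec p s s' t]: started in [s], the program [p] halts in [s'] after [t]
    arithmetical operations and comparisons. *)
Inductive exec (R : realType) : cmd -> state R -> state R -> nat -> Prop :=
| ExecSkip s : exec Skip s s 0
| ExecISet a i e s :
    exec (ISet a i e) s
      (State (upd (imem s) a (ieval s i) (ieval s e)) (emem s))
      (icost i + icost e)
| ExecESet a i e s :
    exec (ESet a i e) s
      (State (imem s) (upd (emem s) a (ieval s i) (eeval s e)))
      (icost i + ecost e)
| ExecSeq p q s s' s'' t u :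
    exec p s s' t -> exec q s' s'' u -> exec (Seq p q) s s'' (t + u)
| ExecIfTrue b p q s s' t :
    beval s b -> exec p s s' t -> exec (If b p q) s s' (bcost b + t)
| ExecIfFalse b p q s s' t :
    ~~ beval s b -> exec q s s' t -> exec (If b p q) s s' (bcost b + t)
| ExecWhileFalse b p s :
    ~~ beval s b -> exec (While b p) s s (bcost b)
| ExecWhileTrue b p s s' s'' t u :
    beval s b -> exec p s s' t -> exec (While b p) s' s'' u ->
    exec (While b p) s s'' (bcost b + t + u).

Lemma exec_det (R : realType) p (s s1 s2 : state R) t1 t2 :
  exec p s s1 t1 -> exec p s s2 t2 -> s1 = s2 /\ t1 = t2.
Proof.
move=> e1; elim: e1 s2 t2 => {p s s1 t1}
  [s|a i e s|a i e s|p q s s' s'' t u _ IHp _ IHq|b p q s s' t hb _ IH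
  |b p q s s' t hb _ IH|b p s hb|b p s s' s'' t u hb _ IHp _ IHw] s2 t2 E;
  inversion E as [| | |? ? ? r ? ? ? E1 E2|? ? ? ? ? ? hb' E1
    |? ? ? ? ? ? hb' E1|? ? ? hb'|? ? ? r ? ? ? hb' E1 E2]; subst => //;
  try by [rewrite hb in hb'|rewrite hb' in hb].
- by case: (IHp _ _ E1) => ? ?; subst; case: (IHq _ _ E2) => ? ?; subst.
- by case: (IH _ _ E1) => ? ?; subst.
- by case: (IH _ _ E1) => ? ?; subst.
- by case: (IHp _ _ E1) => ? ?; subst; case: (IHw _ _ E2) => ? ?; subst.
Qed.

(** Input: [n] in cell 0 of index array 0 and the coefficients in cells
    0, ..., n of extended real array 0.  All other cells contain 0. *)
Definition input (R : realType) (n : nat) (P : 'I_n.+1 -> \bar R) : state R :=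
  State (fun a i => if (a == 0%N) && (i == 0%N) then n else 0%N)
        (fun a i => if a == 0%N then oapp P 0 (insub i) else 0).

(** Output: cells 0, ..., n-1 of extended real array 1. *)
Definition output (R : realType) (n : nat) (s : state R) : 'I_n -> \bar R :=
  fun k => emem s 1 k.

(* Main.v *)
Require Import Defs.
From mathcomp Require Import all_boot all_order all_algebra.
From mathcomp Require Import reals constructive_ereal.
From mathcomp Require Import zify.

(** The term P_k + k x of a max-plus polynomial is a line of slope k, so p is
    the upper envelope of n + 1 lines listed by increasing slope, and its roots
    are the abscissas of the breakpoints.  Equivalently they are the opposite
    slopes of the upper concave hull of the points (k, P_k), an edge from u to
    v giving a root of multiplicity v - u.  The points come sorted by abscissa,
    so Graham's scan finds the hull in linear time.

    The scan keeps a stack of vertices V_0 = 0 < V_1 < ... < V_m with the roots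
    C_1 <= ... <= C_m of its edges ([chain]).  The next point k gives the edge
    from V_m to k, with root c = (P_(V_m) - P_k) / (k - V_m).  If C_m <= c the
    point is pushed ([scan_push]).  Otherwise the line of V_m lies below the
    maximum of the lines of V_(m-1) and k ([popped_term_le]), and V_m is
    popped ([scan_pop]).  At all times the lines seen so far are dominated by
    those of the stack and of the current point ([scan_inv]).

    For a stack with sorted roots the maximum of its lines is the factored form
    P_(V_m) + sum_j (V_j - V_(j-1)) max(x, C_j): this is [chain_max_roots],
    proved by adding one vertex at a time.  At the end of the scan V_m = n, and
    the roots are read off by a second loop, which copies C_j to the output
    V_j - V_(j-1) times.

    Infinite coefficients need little extra care.  The point 0 is always the
    bottom of the stack: if P_0 = -oo, the first finite point k yields an edge
    with root -oo of multiplicity k, which is what the factored form requires.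
    Other points with P_k = -oo are skipped.  The sentinel C_0 = -oo prevents
    the bottom from being popped.

    Both loops have loop-free bodies, hence bodies of bounded cost, so it
    suffices to bound the number of iterations ([exec_while]).  An iteration of
    the scan either advances k, possibly with a push, or pops, so
    2 (n + 1 - k) + m decreases; an iteration of the second loop advances the
    output position or the edge. *)

Set Implicit Arguments.
Unset Strict Implicit.
Unset Printing Implicit Defensive.

Import Order.TTheory GRing.Theory Num.Theory.

Local Open Scope ereal_scope.

(** * Lines and their crossings *)

Definition mp_term (R : realType) (P : nat -> \bar R) (k : nat) (x : \bar R) :
  \bar R := P k + x *+ k.

Lemma enatmulDr (R : realType) (x : \bar R) a b :
  x *+ (a + b) = x *+ a + x *+ b.
Proof. exact: (@mulrnDr (\bar R)). Qed.

Lemma lee_natmul (R : realType) (x y : \bar R) d : x <= y -> x *+ d <= y *+ d.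
Proof.
move=> xy; elim: d => [|d IH]; first by rewrite !mule0n.
by rewrite !muleS leeD.
Qed.

(** For finite coefficients, [c] is the abscissa at which the lines of [u] and
    [v] meet.  Stated without division or subtraction, the condition also makes
    sense in max-plus arithmetic: for [u < v] and [P v] finite, [c] is [-oo] if
    [P u] is. *)
Definition crossing (R : realType) (P : nat -> \bar R) (u v : nat)
  (c : \bar R) : Prop := P u = P v + c *+ (v - u).

(** The line of [v] is the steeper one, so it is above to the right of the
    crossing and below to the left. *)
Lemma mp_term_crossing (R : realType) (P : nat -> \bar R) u v c x :
  (u <= v)%N -> crossing P u v c ->
  (c <= x -> mp_term P u x <= mp_term P v x) /\
  (x <= c -> mp_term P v x <= mp_term P u x).
Proof.
move=> uv cr; rewrite /mp_term cr.
rewrite -[in x *+ v](subnK uv) enatmulDr addeA.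
by split=> h; rewrite leeD2r // leeD2l // lee_natmul.
Qed.

(** [P u] may be [-oo]: the quotient is then [-oo], again a crossing. *)
Lemma crossing_root (R : realType) (P : nat -> \bar R) u v : (u < v)%N ->
  P u != +oo -> P v \is a fin_num ->
  let c := (P u - P v) / ((v - u)%:R%R)%:E in c != +oo /\ crossing P u v c.
Proof.
move=> uv; rewrite /crossing; have d0 : ((v - u)%:R != 0 :> R)%R.
  by rewrite pnatr_eq0 -lt0n subn_gt0.
case: (P u) (P v) => [a| |] // [b| |] //= _ _.
- rewrite inver (negPf d0); split=> //.
  rewrite -EFinD -?EFinM -EFin_natmul -EFinD; congr (_%:E).
  by rewrite -(mulr_natr (_ / _)) divfK // addrC subrK.
- rewrite inver (negPf d0) addNye mulNyr gtr0_sg ?mul1e; last first.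
    by rewrite invr_gt0 ltr0n subn_gt0.
  split=> //; case: (v - u)%N d0 => [|d]; rewrite ?eqxx //.
  by rewrite enatmul_ninfty addeNy.
Qed.

(** * The stack of the scan *)

(** [C j.+1] belongs to the edge from [V j] to [V j.+1]; [C 0] belongs to no
    edge and is the sentinel that protects the bottom of the stack. *)
Record chain (R : realType) (P : nat -> \bar R) (V : nat -> nat)
    (C : nat -> \bar R) (m : nat) : Prop := Chain {
  chain0 : V 0%N = 0%N /\ C 0%N = -oo;
  chain_ltS : forall j, (j < m)%N -> (V j < V j.+1)%N;
  chain_leS : forall j, (j < m)%N -> C j <= C j.+1;
  chain_neqy : forall j, (j <= m)%N -> C j != +oo;
  chain_crossing : forall j, (j < m)%N -> crossing P (V j) (V j.+1) (C j.+1)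
}.

Lemma chain_pop (R : realType) (P : nat -> \bar R) V C m :
  chain P V C m.+1 -> chain P V C m.
Proof.
case=> *; split=> // j jm.
all: by match goal with H : forall i, is_true _ -> _ |- _ =>
  apply: H; exact: leqW end.
Qed.

Lemma chain_push (R : realType) (P : nat -> \bar R) V C m k c :
  chain P V C m -> (V m < k)%N -> C m <= c -> c != +oo ->
  crossing P (V m) k c ->
  chain P (fun j => if j == m.+1 then k else V j)
          (fun j => if j == m.+1 then c else C j) m.+1.
Proof.
move=> [h0 hV hC hy hP] Vk Cc cy cr.
have old j : (j < m.+1)%N -> (j == m.+1) = false by move=> ?; rewrite ltn_eqF.
split=> //= j.
- move=> jm; rewrite old // eqSS; case: eqP => [->//|/eqP ne].
  by apply: hV; rewrite ltn_neqAle ne.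
- move=> jm; rewrite old // eqSS; case: eqP => [->//|/eqP ne].
  by apply: hC; rewrite ltn_neqAle ne.
- by case: (j =P m.+1) => // /eqP ne jm; apply: hy; rewrite -ltnS ltn_neqAle ne.
- move=> jm; rewrite old // eqSS; case: eqP => [->//|/eqP ne].
  by apply: hP; rewrite ltn_neqAle ne.
Qed.

Lemma chain_lt (R : realType) (P : nat -> \bar R) V C m i j :
  chain P V C m -> (i < j <= m)%N -> (V i < V j)%N.
Proof.
move=> h; elim: j => [|j IH] //; rewrite ltnS => /andP[]; rewrite leq_eqVlt.
case/orP => [/eqP-> /(chain_ltS h)//|ij jm].
by apply: ltn_trans (chain_ltS h jm); apply: IH; rewrite ij ltnW.
Qed.

Lemma chain_le (R : realType) (P : nat -> \bar R) V C m j :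
  chain P V C m -> (j <= m)%N -> (V j <= V m)%N.
Proof.
move=> h; rewrite leq_eqVlt => /orP[/eqP->//|jm].
by rewrite ltnW // (chain_lt h) // jm /=.
Qed.

Lemma chain_ge_id (R : realType) (P : nat -> \bar R) V C m :
  chain P V C m -> (m <= V m)%N.
Proof.
elim: m => // m IH h; apply: leq_ltn_trans (chain_ltS h (ltnSn m)).
exact: IH (chain_pop h).
Qed.

Definition chain_max (R : realType) (P : nat -> \bar R) (V : nat -> nat)
    (m : nat) (x : \bar R) : \bar R :=
  \big[maxe/-oo]_(j < m.+1) mp_term P (V j) x.

Lemma chain_maxS (R : realType) (P : nat -> \bar R) V m x :
  chain_max P V m.+1 x = maxe (chain_max P V m x) (mp_term P (V m.+1) x).
Proof. by rewrite /chain_max big_ord_recr. Qed.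

Lemma chain_max_ext (R : realType) (P : nat -> \bar R) V W m x :
  (forall j, (j <= m)%N -> V j = W j) ->
  chain_max P V m x = chain_max P W m x.
Proof. by move=> VW; apply: eq_bigr => j _; rewrite VW // -ltnS. Qed.

Lemma mp_term_le_chain_max (R : realType) (P : nat -> \bar R) V m j x :
  (j <= m)%N -> mp_term P (V j) x <= chain_max P V m x.
Proof.
move=> jm; rewrite /chain_max.
exact: (le_bigmax_cond _ (fun i : 'I_m.+1 => mp_term P (V i) x)
          (j := Ordinal (jm : j < m.+1)%N)).
Qed.

Definition roots_sum (R : realType) (V : nat -> nat) (C : nat -> \bar R)
    (m : nat) (x : \bar R) : \bar R :=
  \sum_(j < m) maxe x (C j.+1) *+ (V j.+1 - V j).

Lemma roots_sumS (R : realType) V (C : nat -> \bar R) m x :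
  roots_sum V C m.+1 x =
  roots_sum V C m x + maxe x (C m.+1) *+ (V m.+1 - V m).
Proof. by rewrite /roots_sum big_ord_recr. Qed.

Lemma roots_sum_ge (R : realType) (P : nat -> \bar R) V C m x :
  chain P V C m -> x *+ V m <= roots_sum V C m x.
Proof.
elim: m => [|m IH] h; first by rewrite /roots_sum big_ord0 (proj1 (chain0 h)).
rewrite roots_sumS -{1}(subnKC (ltnW (chain_ltS h (ltnSn m)))) enatmulDr.
by rewrite leeD ?IH ?lee_natmul ?le_max ?lexx //; exact: chain_pop.
Qed.

Lemma roots_sum_right (R : realType) (P : nat -> \bar R) V C m x :
  chain P V C m -> C m <= x -> roots_sum V C m x = x *+ V m.
Proof.
elim: m => [|m IH] h Cx.
  by rewrite /roots_sum big_ord0 (proj1 (chain0 h)).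
rewrite roots_sumS IH ?(max_idPl Cx); first last.
- exact: le_trans (chain_leS h (ltnSn m)) Cx.
- exact: chain_pop.
by rewrite -enatmulDr subnKC // ltnW // (chain_ltS h).
Qed.

(** Adding a vertex [v = V m.+1] with crossing [c = C m.+1] to a chain ending
    in [u].  For [c <= x] the point [x] is to the right of all crossings, every
    factor is [x], and the new line is the maximum.  For [x < c] the new factor
    is [c], which turns [P v] back into [P u]; the new line is below that of
    [u] and changes nothing. *)
Lemma chain_max_roots (R : realType) (P : nat -> \bar R) V C m x :
  chain P V C m -> chain_max P V m x = P (V m) + roots_sum V C m x.
Proof.
elim: m => [|m IH] h.
  by rewrite /chain_max /roots_sum big_ord_recr !big_ord0 /= maxNye /mp_term
             (proj1 (chain0 h)).
have h' := chain_pop h; have cr := chain_crossing h (ltnSn m).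
have [tR tL] := mp_term_crossing x (ltnW (chain_ltS h (ltnSn m))) cr.
rewrite chain_maxS IH //; have [Cx|xC] := leP (C m.+1) x.
  rewrite (roots_sum_right h Cx).
  rewrite (roots_sum_right h' (le_trans (chain_leS h (ltnSn m)) Cx)).
  by apply/max_idPr; exact: tR.
rewrite roots_sumS (max_idPr (ltW xC)) addeA addeAC -cr.
apply/max_idPl; apply: le_trans (tL (ltW xC)) _.
by rewrite leeD2l // (roots_sum_ge x h').
Qed.

(** From left to right, the line of [v] is overtaken by that of [k], at [c],
    no later than it overtakes that of [u], at [c']: it never shows. *)
Lemma popped_term_le (R : realType) (P : nat -> \bar R) u v k c c' x :
  (u <= v <= k)%N -> crossing P u v c' -> crossing P v k c -> c <= c' ->
  mp_term P v x <= maxe (mp_term P u x) (mp_term P k x).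
Proof.
move=> /andP[uv vk] cuv cvk cc; rewrite le_max.
have [_ tL] := mp_term_crossing x uv cuv.
have [tR _] := mp_term_crossing x vk cvk.
by have [/tR->|/ltW xc] := leP c x; rewrite ?orbT // tL ?(le_trans xc).
Qed.

(** * The scan *)

(** In [scan_max], the line of the current point [k] is included because it is
    what dominates the vertices that have just been popped.  The statement is
    also meant for [k = n.+1], with [P n.+1 = -oo]. *)
Record scan_inv (R : realType) (n : nat) (P : nat -> \bar R) (k m : nat)
    (V : nat -> nat) (C : nat -> \bar R) : Prop := ScanInv {
  scan_chain : chain P V C m;
  scan_range : (V m < k <= n.+1)%N;
  scan_last : k = n.+1 -> V m = n;
  scan_max : forall i x, (i < k)%N ->
    mp_term P i x <= maxe (chain_max P V m x) (mp_term P k x)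
}.

Lemma scan_init (R : realType) n (P : nat -> \bar R) V C :
  V 0%N = 0%N -> C 0%N = -oo -> scan_inv n P 1 0 V C.
Proof.
move=> V0 C0; split=> //.
- by split=> // -[|j] //=; rewrite C0.
- by rewrite V0.
- by rewrite V0 => -[].
- by move=> [|//] x _; rewrite le_max -{1}V0 mp_term_le_chain_max.
Qed.

Lemma scan_skip (R : realType) n (P : nat -> \bar R) k m V C :
  scan_inv n P k m V C -> (k <= n)%N -> P n != -oo -> P k = -oo ->
  scan_inv n P k.+1 m V C.
Proof.
move=> [hc hr _ hm] kn Pn Pk; split=> //.
- by case/andP: hr => h _; rewrite leqW //= ltnS.
- by case=> kn'; rewrite -kn' Pk in Pn.
- move=> i x; rewrite ltnS leq_eqVlt => /orP[/eqP->|/(hm i x)].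
    by rewrite /mp_term Pk addNye leNye.
  by rewrite [mp_term P k x]/mp_term Pk addNye maxeNy le_max => ->.
Qed.

Lemma scan_push (R : realType) n (P : nat -> \bar R) k m V C c :
  scan_inv n P k m V C -> (k <= n)%N -> crossing P (V m) k c -> c != +oo ->
  C m <= c ->
  scan_inv n P k.+1 m.+1 (fun j => if j == m.+1 then k else V j)
           (fun j => if j == m.+1 then c else C j).
Proof.
move=> [hc /andP[Vk _] _ hm] kn cr cy Cc; split.
- exact: chain_push.
- by rewrite eqxx leqnn ltnS.
- by rewrite eqxx => -[].
- move=> i x; rewrite ltnS => ik; rewrite le_max chain_maxS eqxx.
  rewrite (@chain_max_ext _ _ _ V); last by move=> j jm; rewrite ltn_eqF.
  apply/orP; left; move: ik; rewrite leq_eqVlt => /orP[/eqP->|]; last exact: hm.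
  by rewrite le_max lexx orbT.
Qed.

Lemma scan_pop (R : realType) n (P : nat -> \bar R) k m V C c :
  scan_inv n P k m.+1 V C -> (k <= n)%N -> crossing P (V m.+1) k c ->
  c <= C m.+1 -> scan_inv n P k m V C.
Proof.
move=> [hc /andP[Vk kn1] _ hm] kn cr cC.
have Vm := chain_ltS hc (ltnSn m).
split; first exact: chain_pop.
- by rewrite (ltn_trans Vm).
- by move=> k1; rewrite k1 ltnn in kn.
- move=> i x /(hm i x) /le_trans; apply; rewrite chain_maxS.
  rewrite !ge_max !le_max !lexx /= orbT andbT.
  have := popped_term_le (k := k) x _ (chain_crossing hc (ltnSn m)) cr cC.
  rewrite (ltnW Vm) (ltnW Vk) => /(_ isT); rewrite le_max => /orP[h|->].
    by rewrite (le_trans h) // mp_term_le_chain_max.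
  by rewrite orbT.
Qed.

(** The converse bound of [scan_max] is clear, the lines of the stack being
    among those of the polynomial. *)
Lemma scan_done (R : realType) n (P : nat -> \bar R) m V C x :
  scan_inv n P n.+1 m V C -> P n.+1 = -oo ->
  \big[maxe/-oo]_(i < n.+1) mp_term P i x = P n + roots_sum V C m x.
Proof.
move=> [hc _ /(_ erefl) Vn hm] Pn1; rewrite -[in P n]Vn -(chain_max_roots x hc).
apply/le_anti/andP; split; apply/bigmax_leP; split; rewrite ?leNye // => i _.
  have := hm i x (ltn_ord i).
  by rewrite [mp_term _ n.+1 x]/mp_term Pn1 addNye maxeNy.
have Vi : (V i < n.+1)%N by rewrite ltnS -Vn (chain_le hc) // -ltnS.
exact: (le_bigmax_cond _ (fun i : 'I_n.+1 => mp_term P i x) (j := Ordinal Vi)).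
Qed.

(** * Copying the roots *)

(** In [fill_sum], the second summand stands for the copies of [C j] that are
    still to be written, so that moving to the next edge when none is left, or
    writing one copy, trivially preserves the equation. *)
Record fill_inv (R : realType) (m : nat) (V : nat -> nat) (C : nat -> \bar R)
    (i j : nat) (out : nat -> \bar R) : Prop := FillInv {
  fill_edge : (j <= m)%N;
  fill_pos : (i <= V j)%N;
  fill_neqy : forall k, (k < i)%N -> out k != +oo;
  fill_sum : forall x,
    \sum_(k < i) maxe x (out k) + maxe x (C j) *+ (V j - i) = roots_sum V C j x
}.

(** The edges are not exhausted before the output is full: an edge that ends
    before [n = V m] cannot be the last. *)
Lemma fill_next (R : realType) (P : nat -> \bar R) n m V C i j out :
  chain P V C m -> V m = n -> fill_inv m V C i j out -> (i < n)%N ->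
  (V j <= i)%N -> (j < m)%N /\ fill_inv m V C i j.+1 out.
Proof.
move=> hc Vm [jm ij oy hs] lin ji.
have ltjm : (j < m)%N.
  move: jm; rewrite leq_eqVlt => /orP[/eqP jm|//].
  by rewrite -Vm -jm ltnNge ji in lin.
have eij : i = V j by apply/eqP; rewrite eqn_leq ij.
have Vj := chain_ltS hc ltjm.
split=> //; split=> //; first by rewrite eij ltnW.
by move=> x; rewrite roots_sumS -hs -eij subnn mule0n adde0.
Qed.

Lemma fill_write (R : realType) (P : nat -> \bar R) m V C i j out :
  chain P V C m -> fill_inv m V C i j out -> (i < V j)%N ->
  fill_inv m V C i.+1 j (fun k => if k == i then C j else out k).
Proof.
move=> hc [jm ij oy hs] lij; split=> //.
- move=> k; case: (k =P i) => [_ _|/eqP ki]; first exact: (chain_neqy hc jm).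
  by rewrite ltnS leq_eqVlt (negPf ki) /=; exact: oy.
- move=> x; rewrite big_ord_recr /= eqxx -hs -addeA; congr (_ + _).
    by apply: eq_bigr => k _; rewrite ltn_eqF.
  by rewrite -muleS -subSn // subSS.
Qed.

Lemma fill_done (R : realType) (P : nat -> \bar R) n m V C i j out :
  chain P V C m -> V m = n -> fill_inv m V C i j out -> (n <= i)%N ->
  forall x, \sum_(k < n) maxe x (out k) = roots_sum V C m x.
Proof.
move=> hc Vm [jm ij oy hs] ni x.
have Vj : (V j <= V m)%N by apply: chain_le hc jm.
have iV : i = V m by apply/eqP; rewrite eqn_leq (leq_trans ij Vj) Vm ni.
have jE : j = m.
  move: jm; rewrite leq_eqVlt => /orP[/eqP//|jm].
  have := @chain_lt _ _ _ _ _ j m hc.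
  by rewrite jm leqnn ltnNge -iV ij => /(_ isT).
by have := hs x; rewrite jE iV Vm subnn mule0n adde0.
Qed.

(** * Cost of programs *)

Fixpoint loop_free (p : cmd) : bool :=
  match p with
  | Seq p q | If _ p q => loop_free p && loop_free q
  | While _ _ => false
  | _ => true
  end.

Fixpoint run (R : realType) (p : cmd) (s : state R) : state R :=
  match p with
  | Skip | While _ _ => s
  | ISet a i e => State (upd (imem s) a (ieval s i) (ieval s e)) (emem s)
  | ESet a i e => State (imem s) (upd (emem s) a (ieval s i) (eeval s e))
  | Seq p q => run q (run p s)
  | If b p q => if beval s b then run p s else run q s
  end.

Fixpoint max_cost (p : cmd) : nat :=
  match p with
  | Skip | While _ _ => 0
  | ISet _ i e => icost i + icost e
  | ESet _ i e => icost i + ecost e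
  | Seq p q => max_cost p + max_cost q
  | If b p q => bcost b + maxn (max_cost p) (max_cost q)
  end.

Lemma exec_loop_free (R : realType) p (s : state R) : loop_free p ->
  exists t, exec p s (run p s) t /\ (t <= max_cost p)%N.
Proof.
elim: p s => [|a i e|a i e|p IHp q IHq|b p IHp q IHq|//] s /=.
- by exists 0%N; split=> //; exact: ExecSkip.
- by exists (icost i + icost e)%N; split=> //; exact: ExecISet.
- by exists (icost i + ecost e)%N; split=> //; exact: ExecESet.
- move=> /andP[/(IHp s)[t [et lt]] /(IHq (run p s))[u [eu lu]]].
  by exists (t + u)%N; split; [exact: ExecSeq et eu | exact: leq_add].
- move=> /andP[/(IHp s)[t [et lt]] /(IHq s)[u [eu lu]]].
  case: ifPn => hb.
    exists (bcost b + t)%N; split; first exact: ExecIfTrue.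
    by rewrite leq_add2l (leq_trans lt) // leq_maxl.
  exists (bcost b + u)%N; split; first exact: ExecIfFalse.
  by rewrite leq_add2l (leq_trans lu) // leq_maxr.
Qed.

(** Total correctness of a loop with a loop-free body: a variant [mu] bounds the
    number of iterations, hence the cost, whose additional unit in [(mu s).+1]
    pays for the last test of the guard. *)
Lemma exec_while (R : realType) (I : state R -> Prop) (mu : state R -> nat)
    b p (s : state R) :
  loop_free p ->
  (forall s, I s -> beval s b -> I (run p s) /\ (mu (run p s) < mu s)%N) ->
  I s ->
  exists s' t, [/\ exec (While b p) s s' t, I s', ~~ beval s' b &
    (t <= (mu s).+1 * (bcost b + max_cost p))%N].
Proof.
move=> lf step; have [N] := ubnP (mu s); elim: N s => // N IH s muN Is.
have [hb|hb] := boolP (beval s b); last first.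
  exists s, (bcost b); split=> //; first exact: ExecWhileFalse.
  by rewrite mulSn -addnA leq_addr.
have [Is' mus] := step s Is hb.
have [t [et lt]] := exec_loop_free s lf.
have [s' [u [eu Is'' hb' lu]]] := IH _ (leq_trans mus muN) Is'.
exists s', (bcost b + t + u)%N; split=> //; first exact: ExecWhileTrue eu.
rewrite mulSn leq_add ?leq_add2l // (leq_trans lu) //.
by rewrite leq_mul2r mus orbT.
Qed.

(** * The program *)

(** The cells of index array 0 hold, in this order, the degree [n], the
    current point and the top [m] of the stack of the scan, and then the output
    position and the current edge of the copying loop.  The stack is made of
    index array 1 (vertices) and extended real array 2 (roots). *)
Definition deg_exp := IGet 0 (INum 0).
Definition next_exp := IGet 0 (INum 1).
Definition top_exp := IGet 0 (INum 2).
Definition pos_exp := IGet 0 (INum 3).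
Definition edge_exp := IGet 0 (INum 4).
Definition vertex_exp (e : iexp) := IGet 1 e.
Definition coef_exp (e : iexp) := EGet 0 e.
Definition root_exp (e : iexp) := EGet 2 e.
Definition incr (a : nat) := ISet 0 (INum a) (IAdd (IGet 0 (INum a)) (INum 1)).

Definition edge_root_exp : eexp :=
  EDiv (ESub (coef_exp (vertex_exp top_exp)) (coef_exp next_exp))
       (EOfIdx (ISub next_exp (vertex_exp top_exp))).

Definition scan_guard : bexp := BLeI next_exp deg_exp.

Definition scan_body : cmd :=
  If (BLeE (coef_exp next_exp) ENInfty)
    (incr 1)
    (If (BLeE (root_exp top_exp) edge_root_exp)
      (Seq (ESet 2 (IAdd top_exp (INum 1)) edge_root_exp)
      (Seq (ISet 1 (IAdd top_exp (INum 1)) next_exp)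
      (Seq (incr 2) (incr 1))))
      (ISet 0 (INum 2) (ISub top_exp (INum 1)))).

Definition fill_guard : bexp := BNot (BLeI deg_exp pos_exp).

Definition fill_body : cmd :=
  If (BLeI (vertex_exp edge_exp) pos_exp)
    (incr 4)
    (Seq (ESet 1 pos_exp (root_exp edge_exp)) (incr 3)).

Definition scan_setup : cmd :=
  Seq (ESet 2 (INum 0) ENInfty) (ISet 0 (INum 1) (INum 1)).

Definition fill_setup : cmd :=
  Seq (ISet 0 (INum 3) (INum 0)) (ISet 0 (INum 4) (INum 0)).

Definition roots_program : cmd :=
  Seq scan_setup (Seq (While scan_guard scan_body)
 (Seq fill_setup (While fill_guard fill_body))).

(** * Correctness of the program *)

(** The value outside of the range is [-oo], not the [0] found in memory, so
    that the nonexistent line [n.+1] has no influence on [scan_max]. *)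
Definition coef (R : realType) n (P : 'I_n.+1 -> \bar R) (i : nat) : \bar R :=
  oapp P (-oo) (insub i).

Lemma coef_ord (R : realType) n (P : 'I_n.+1 -> \bar R) (i : 'I_n.+1) :
  coef P i = P i.
Proof. by rewrite /coef valK. Qed.

Lemma coef_neqy (R : realType) n (P : 'I_n.+1 -> \bar R) i :
  (forall k, in_Rmax (P k)) -> coef P i != +oo.
Proof. by move=> hP; rewrite /coef; case: insub => [k|] //=; exact: hP. Qed.

Definition scan_state (R : realType) n (P : 'I_n.+1 -> \bar R)
    (s : state R) : Prop :=
  [/\ imem s 0%N 0%N = n,
      forall i, (i <= n)%N -> emem s 0%N i = coef P i &
      scan_inv n (coef P) (imem s 0%N 1%N) (imem s 0%N 2%N)
               (imem s 1%N) (emem s 2%N)].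

(** A push consumes a point but lengthens the stack, hence the weight 2 of the
    points. *)
Definition scan_measure (R : realType) (s : state R) : nat :=
  (2 * ((imem s 0 0).+1 - imem s 0 1) + imem s 0 2)%N.

Lemma scan_step (R : realType) n (P : 'I_n.+1 -> \bar R) (s : state R) :
  mp_poly P -> scan_state P s -> beval s scan_guard ->
  scan_state P (run scan_body s) /\
  (scan_measure (run scan_body s) < scan_measure s)%N.
Proof.
move=> [Py Pn] [sn sP hs] /=; rewrite sn => kn.
have Vk : (imem s 1 (imem s 0 2) < imem s 0 1)%N by case/andP: (scan_range hs).
have Pn' : coef P n != -oo by have := coef_ord P ord_max; move=> /= ->.
rewrite leeNy_eq sP //; case: ifPn => [/eqP Pk|Pk].
  split; last by rewrite /scan_measure /= /upd /= sn; lia.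
  by split=> //=; rewrite /upd /= addn1; exact: scan_skip.
have Pfin : coef P (imem s 0%N 1%N) \is a fin_num.
  by rewrite fin_numE Pk coef_neqy.
rewrite sP ?(leq_trans (ltnW Vk)) //.
have [cy cr] := crossing_root Vk (coef_neqy _ Py) Pfin.
case: ifPn => [Cc|].
  split; last by rewrite /scan_measure /= /upd /= sn; lia.
  split=> //=; rewrite /upd /= !addn1 /=.
  exact: scan_push.
rewrite -ltNge => cC; case Em : (imem s 0%N 2%N) cC => [|m] cC.
  (* The sentinel: the bottom of the stack passes every comparison. *)
  by rewrite (proj2 (chain0 (scan_chain hs))) ltNge leNye in cC.
split; last by rewrite /scan_measure /= /upd /= sn Em; lia.
split=> //=; rewrite /upd /= subn1.
by rewrite Em in hs cr; exact: scan_pop hs kn cr (ltW cC).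
Qed.

Definition fill_state (R : realType) n (m : nat) (V : nat -> nat)
    (C : nat -> \bar R) (s : state R) : Prop :=
  [/\ imem s 0%N 0%N = n, imem s 1%N = V, emem s 2%N = C &
      fill_inv m V C (imem s 0%N 3%N) (imem s 0%N 4%N) (emem s 1%N)].

Definition fill_measure (R : realType) (m : nat) (s : state R) : nat :=
  ((imem s 0 0 - imem s 0 3) + (m - imem s 0 4))%N.

Lemma fill_step (R : realType) n (P : nat -> \bar R) m V C (s : state R) :
  chain P V C m -> V m = n -> fill_state n m V C s -> beval s fill_guard ->
  fill_state n m V C (run fill_body s) /\
  (fill_measure m (run fill_body s) < fill_measure m s)%N.
Proof.
move=> hc Vm [sn sV sC hs] /=; rewrite sn -ltnNge sV => lin.
case: ifPn => [Vi|]; last rewrite -ltnNge => iV.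
  have [jm hs'] := fill_next hc Vm hs lin Vi.
  split; last by rewrite /fill_measure /= /upd /= sn; lia.
  by split=> //=; rewrite /upd /= addn1.
split; last by rewrite /fill_measure /= /upd /= sn; lia.
split=> //=; rewrite /upd /= addn1 sC.
exact: fill_write hc hs iV.
Qed.

Theorem proposition1 (R : realType) :
  exists (roots_algorithm : cmd) (K : nat),
    forall (n : nat) (P : 'I_n.+1 -> \bar R),
      (1 <= n)%N -> mp_poly P ->
      exists (s : state R) (t : nat),
        exec roots_algorithm (input P) s t
        /\ mp_roots P (output (n := n) s)
        /\ (t <= K * n)%N.
Proof.
exists roots_program.
(* The variants start at 2 n and at n + m <= 2 n, so that each loop performs
   at most 2 n + 1 <= 3 n tests. *)
exists (3 * (bcost scan_guard + max_cost scan_body) +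
        3 * (bcost fill_guard + max_cost fill_body))%N.
move=> n P n1 mpP.
have [t0 [e0 l0]] := @exec_loop_free R scan_setup (input P) isT.
have I0 : scan_state P (run scan_setup (input P)).
  split=> //=; last exact: scan_init.
  by move=> i lin; rewrite /upd /= /coef (insubT (fun i => i < n.+1)%N).
have [s1 [t1 [e1 [sn sP hs] g1 l1]]] :=
  exec_while (b := scan_guard) (p := scan_body)
    isT (fun s => @scan_step R n P s mpP) I0.
set m := imem s1 0%N 2%N in hs.
have k1 : imem s1 0%N 1%N = n.+1.
  move: g1 (scan_range hs) => /=; rewrite sn -ltnNge => nk /andP[_ kn].
  by apply/eqP; rewrite eqn_leq kn.
rewrite k1 in hs; have hc := scan_chain hs.
have Vm : imem s1 1%N m = n := scan_last hs erefl.
have [t2 [e2 l2]] := @exec_loop_free R fill_setup s1 isT.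
have I2 : fill_state n m (imem s1 1%N) (emem s1 2%N) (run fill_setup s1).
  split=> //=; rewrite /upd /=; split=> // x.
  by rewrite /roots_sum !big_ord0 (proj1 (chain0 hc)) subnn mule0n adde0.
have [s3 [t3 [e3 [sn3 _ _ hf] g3 l3]]] :=
  exec_while (b := fill_guard) (p := fill_body)
    isT (fun s => @fill_step R n _ m _ _ s hc Vm) I2.
have ni : (n <= imem s3 0 3)%N by move: g3; rewrite /= sn3 negbK.
exists s3, (t0 + (t1 + (t2 + t3)))%N; split; last split.
- exact: ExecSeq e0 (ExecSeq e1 (ExecSeq e2 e3)).
- split=> [k|x _]; first by apply: (fill_neqy hf); exact: leq_trans ni.
  have Pn1 : coef P n.+1 = -oo by rewrite /coef insubF // ltnn.
  have Pn : coef P n = P ord_max := coef_ord P ord_max.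
  rewrite -Pn (fill_done hc Vm hf ni x) -(scan_done x hs Pn1).
  by apply: eq_bigr => k _; rewrite /mp_term coef_ord.
- have mn : (m <= n)%N by rewrite -Vm; exact: chain_ge_id hc.
  move: l0 l2; rewrite !leqn0 => /eqP-> /eqP->; rewrite !add0n mulnDl.
  apply: leq_add; [apply: leq_trans l1 _ | apply: leq_trans l3 _].
    rewrite mulnAC leq_mul2r; apply/orP; right.
    by rewrite /scan_measure /= /upd /=; lia.
  rewrite mulnAC leq_mul2r; apply/orP; right.
  by rewrite /fill_measure /= /upd /= sn; lia.
Qed.
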